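(* Let $G$ be a finite weighted graph and let $H$ be a parametrix of order $k\geq 0$ for the heat operator $L=\Delta_G+\partial_t$ on $G$. For $v_1,v_2\in VG$ and $t\in\mathbb{R}_{\geq 0}$ define $$F(v_1,v_2;t):=\sum_{\ell=1}^{\infty}(-1)^{\ell}(L_{v_1}H)^{\ast\ell}(v_1,v_2;t).$$ Then this series converges absolutely and uniformly on every compact subset of $VG\times VG\times\mathbb{R}_{\geq 0}$. Furthermore, the heat kernel $H_G$ on $G$ associated to the graph Laplacian $\Delta_{G,v_1}$ is given by $$H_G(v_1,v_2;t)=H(v_1,v_2;t)+(H\ast F)(v_1,v_2;t),$$ with $$(H\ast F)(v_1,v_2;t)=O(t^{k+1})\quad\text{as } t\to 0.$$
   Context: $G$ is a finite edge-weighted graph with finite vertex set $VG$ (discrete topology) and weight function $w:VG\times VG\to[0,\infty)$, $w_{xy}=w_{yx}$ ($w_{xy}=0$ means there is no edge between $x$ and $y$). The Laplacian acts on functions on $VG$ by $\Delta_Gf(x)=\sum_{y\in VG}(f(x)-f(y))w_{xy}$. The heat operator is $L=\Delta_G+\frac{\partial}{\partial t}$; $L_{v_1}$ and $\Delta_{G,v_1}$ denote the operators acting in the first vertex variable $v_1$. The heat kernel $H_G$ on $VG\times VG\times[0,\infty)$ is the unique solution of $L_{v_1}H_G(v_1,v_2;t)=0$ ($t>0$) with $H_G(v_1,v_2;0)=\lim_{t\to0}H_G(v_1,v_2;t)$ equal to $1$ if $v_1=v_2$ and $0$ if $v_1\neq v_2$. A parametrix for the heat operator on $G$ is a continuous real-valued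 function $H$ on $VG\times VG\times[0,\infty)$, smooth on $VG\times VG\times(0,\infty)$, such that (1) for all $v_1,v_2\in VG$, $H(v_1,v_2;0)=\lim_{t\to0}H(v_1,v_2;t)$ equals $1$ if $v_1=v_2$ and $0$ if $v_1\ne v_2$; (2) $L_{v_1}H(v_1,v_2;t)$ extends to a continuous function on $VG\times VG\times[0,\infty)$. It has order $k$, for an integer $k\ge0$, if $|L_{v_1}H(v_1,v_2;t)|=O(t^k)$ as $t\to0$. In the series, $L_{v_1}H$ at $t=0$ means the value of the continuous extension. The convolution of functions $F_1,F_2$ of $(v_1,v_2;t)$ that are integrable in $t$ on every $(0,b]$, $b>0$, is $$(F_1\ast F_2)(v_1,v_2;t)=\int_0^t\sum_{v\in VG}F_1(v_1,v;t-r)F_2(v,v_2;r)\,dr.$$ It is associative; $(f)^{\ast1}=f$ and $(f)^{\ast\ell}=(f)^{\ast(\ell-1)}\ast f$ for $\ell\geq2$. *)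

(* Defs.v *)
From HB Require Import structures.
From mathcomp Require Import all_boot all_order all_algebra.
From mathcomp Require Import all_classical all_reals all_analysis.

Set Implicit Arguments.
Unset Strict Implicit.
Unset Printing Implicit Defensive.

Import Order.TTheory GRing.Theory Num.Theory.
Import numFieldNormedType.Exports.

Local Open Scope classical_set_scope.
Local Open Scope ring_scope.

Record weighted_graph (R : realType) := WeightedGraph {
  vertex :> finType;
  weight : vertex -> vertex -> R;
  weight_ge0 : forall x y, 0 <= weight x y;
  weight_sym : forall x y, weight x y = weight y x }.

(* Functions of (v1, v2; t) with t >= 0 are represented by functions that are
   total in t; the predicates below only constrain their values for t >= 0. *)
Definition heat_fun (R : realType) (G : weighted_graph R) : Type :=
  G -> G -> R -> R.

(* VG is given the discrete topology, the triple the product topology. *)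
Notation spacetime R G :=
  (discrete_topology (vertex G) * discrete_topology (vertex G) * R)%type.

Section heat.
Context {R : realType} {G : weighted_graph R}.
Implicit Types F H K : heat_fun G.

Definition on_spacetime F : spacetime R G -> R := fun p => F p.1.1 p.1.2 p.2.

Definition time_ge0 : set (spacetime R G) := [set p | 0 <= p.2].

Definition laplacian (f : G -> R) (x : G) : R :=
  \sum_(y : G) (f x - f y) * weight x y.

(* The Laplacian acts in the first vertex variable.  The time derivative is
   meaningful only where F v1 v2 is derivable. *)
Definition heat_op F : heat_fun G := fun v1 v2 t =>
  laplacian (fun v => F v v2 t) v1 + derive1 (F v1 v2) t.

(* The continuous extension of [heat_op F] to t = 0, when there is one. *)
Definition heat_op_ext F : heat_fun G := fun v1 v2 t =>
  if t == 0 then lim (heat_op F v1 v2 s @[s --> 0^'+]) else heat_op F v1 v2 t.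

Definition dirac_initial F : Prop :=
  forall v1 v2 : G, F v1 v2 0 = (v1 == v2)%:R /\
    F v1 v2 t @[t --> 0^'+] --> ((v1 == v2)%:R : R).

Definition smooth_pos F : Prop :=
  forall (v1 v2 : G) (n : nat) (t : R),
    0 < t -> derivable (derive1n n (F v1 v2)) t 1.

Record is_parametrix H : Prop := IsParametrix {
  parametrix_continuous : {within time_ge0, continuous (on_spacetime H)};
  parametrix_smooth : smooth_pos H;
  parametrix_initial : dirac_initial H;
  parametrix_extension : exists K,
    {within time_ge0, continuous (on_spacetime K)} /\
    forall (v1 v2 : G) (t : R), 0 < t -> K v1 v2 t = heat_op H v1 v2 t }.

(* As VG is finite, it is immaterial whether the constant in O(t^k) may depend
   on (v1, v2). *)
Definition has_order (k : nat) H : Prop :=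
  forall v1 v2 : G, heat_op H v1 v2 =O_ (0^'+) (fun t : R => t ^+ k).

Record solves_heat_eq K : Prop := SolvesHeatEq {
  heat_derivable : forall (v1 v2 : G) (t : R), 0 < t -> derivable (K v1 v2) t 1;
  heat_equation : forall (v1 v2 : G) (t : R), 0 < t -> heat_op K v1 v2 t = 0;
  heat_initial : dirac_initial K }.

(* The solution of the heat equation with Dirac initial condition; it is unique
   on t >= 0, and the values at t < 0 are unspecified. *)
Definition heat_kernel : heat_fun G :=
  xget (fun _ _ _ => 0) [set K : heat_fun G | solves_heat_eq K].

Definition convolution F1 F2 : heat_fun G := fun v1 v2 t =>
  \int[lebesgue_measure]_(r in `[0, t])
    \sum_(v : G) F1 v1 v (t - r) * F2 v v2 r.

(* convolution_pow F l is the l-fold convolution F * ... * F, for l >= 1;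
   convolution_pow F 0 = F is never used. *)
Definition convolution_pow F (l : nat) : heat_fun G :=
  iter l.-1 (fun K => convolution K F) F.

Definition neumann_term H (l : nat) : heat_fun G := fun v1 v2 t =>
  (-1) ^+ l * convolution_pow (heat_op_ext H) l v1 v2 t.

Definition neumann_sum H (n : nat) : heat_fun G := fun v1 v2 t =>
  \sum_(1 <= l < n) neumann_term H l v1 v2 t.

Definition neumann_series H : heat_fun G := fun v1 v2 t =>
  limn (fun n => neumann_sum H n v1 v2 t).

End heat.

Arguments heat_kernel {R} G.
Arguments time_ge0 {R} G.

(* Main.v *)
(* Write P for the continuous extension of LH to t >= 0.  With respect to the
   weight e^(at), a large, convolution with P contracts by 1/2, so the
   series F of alternating convolution powers of P is dominated by a
   geometric series and satisfies F = -P - P * F.  Since H(0) = 1, one has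
   L(H * F) = F + P * F, hence L(H + H * F) = P + F + P * F = 0: the function
   H + H * F solves the heat equation with Dirac initial condition.  Solutions
   are unique because the sum over v of (K1 - K2)(v, v2; t)^2 is nonincreasing
   in t.  Finally P = O(t^k) gives F = O(t^k), and integrating over [0, t] gains
   one more power of t. *)

Require Import Defs.
From mathcomp Require Import all_boot all_order all_algebra.
From mathcomp Require Import all_classical all_reals all_analysis.
From mathcomp Require Import measurable_realfun ring lra.

Set Implicit Arguments.
Unset Strict Implicit.
Unset Printing Implicit Defensive.

Import Order.TTheory GRing.Theory Num.Theory.
Import numFieldNormedType.Exports.
Local Open Scope classical_set_scope.
Local Open Scope ring_scope.

(** * Convolution of functions on the half-line *)

Section scalar_convolution.
Context {R : realType}.
Implicit Types (f g h : R -> R) (t : R).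
Notation mu := (@lebesgue_measure R).

(** Convolutions are only ever manipulated for functions of [t] that are continuous on the whole
    line. The hypotheses speak of [t >= 0] alone, so kernels are precomposed with [clamp]; a
    convolution over [[0, t]] samples its factors at nonnegative times only and does not see the
    change. Since the vertex sums are finite, a kernel convolution is a matrix product of scalar
    ones, and the analysis is done for scalars.

    Associativity enters twice. Convolution powers grow by a factor on the right, whereas the
    equation for [F] splits off a factor on the left. It also gives the time derivative of [H * F]:
    [H] is differentiable only for [t > 0], but its derivative, [P] minus the Laplacian of [H],
    extends continuously to [t = 0], so [H] is its initial value plus the primitive of a continuous
    function, and a primitive is a convolution with the constant 1. *)

Definition conv f g t : R := \int[mu]_(r in `[0, t]) (f (t - r) * g r).

Definition clamp t : R := Num.max t 0.

Lemma clamp_id t : 0 <= t -> clamp t = t.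
Proof. by move=> /max_l. Qed.

Lemma clamp0 t : t <= 0 -> clamp t = 0.
Proof. by move=> /max_r. Qed.

Lemma clamp_ge0 t : 0 <= clamp t.
Proof. by rewrite le_max lexx orbT. Qed.

Lemma continuous_clamp : continuous clamp.
Proof.
move=> t; apply: (@continuous_max R R id (cst 0)); first exact: cvg_id.
exact: cvg_cst.
Qed.

Lemma continuous_integrable_itv f {a b : R} :
  continuous f -> mu.-integrable `[a, b] (EFin \o f).
Proof.
move=> cf; apply: continuous_compact_integrable; first exact: segment_compact.
exact: continuous_subspaceT.
Qed.

Lemma continuous_itv_bounded f (a b : R) : continuous f ->
  exists2 M : R, 0 <= M & forall x, a <= x <= b -> `|f x| <= M.
Proof.
move=> cf; have /compact_bounded : compact (f @` `[a, b]).
  by apply: continuous_compact; [exact: continuous_subspaceT|exact: segment_compact].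
(* The bound holds only for numbers strictly above [M], and [M] may be negative. *)
move=> [M [_ fM]]; exists (`|M| + 1) => // x xab.
by apply: (fM (`|M| + 1)); [rewrite ltr_pwDr// ler_norm|exists x].
Qed.

Lemma continuous_subr f t : continuous f -> continuous (fun r => f (t - r)).
Proof.
move=> cf r; apply: (@continuous_comp _ _ _ (fun r => t - r) f); last exact: cf.
by apply: cvgB; [exact: cvg_cst|exact: cvg_id].
Qed.

Lemma continuous_conv_integrand f g t : continuous f -> continuous g ->
  continuous (fun r => f (t - r) * g r).
Proof. by move=> cf cg r; apply: cvgM; [exact: continuous_subr|exact: cg]. Qed.

Lemma conv_le0 f g t : t <= 0 -> conv f g t = 0.
Proof.
rewrite /conv le_eqVlt => /predU1P[->|t0]; first by rewrite set_itv1 Rintegral_set1.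
by rewrite set_itv_ge ?Rintegral_set0// bnd_simp -ltNge.
Qed.

(** For [r] in [[0, t]] both [r] and [t - r] are nonnegative, so values at negative times never
    matter. *)
Lemma eq_conv f f' g g' t : (forall r, 0 <= r -> f r = f' r) ->
  (forall r, 0 <= r -> g r = g' r) -> conv f g t = conv f' g' t.
Proof.
move=> ff' gg'; apply: eq_Rintegral => r; rewrite inE/= in_itv/= => /andP[r0 rt].
by rewrite ff' ?subr_ge0// gg'.
Qed.

Lemma convDl f f' g t : continuous f -> continuous f' -> continuous g ->
  conv (fun r => f r + f' r) g t = conv f g t + conv f' g t.
Proof.
move=> cf cf' cg; rewrite /conv; under eq_Rintegral do rewrite mulrDl.
by rewrite RintegralD//; apply: continuous_integrable_itv;
  exact: continuous_conv_integrand.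
Qed.

Lemma convDr f g g' t : continuous f -> continuous g -> continuous g' ->
  conv f (fun r => g r + g' r) t = conv f g t + conv f g' t.
Proof.
move=> cf cg cg'; rewrite /conv; under eq_Rintegral do rewrite mulrDr.
by rewrite RintegralD//; apply: continuous_integrable_itv;
  exact: continuous_conv_integrand.
Qed.

Lemma convZl (a : R) f g t : continuous f -> continuous g ->
  conv (fun r => a * f r) g t = a * conv f g t.
Proof.
move=> cf cg; rewrite /conv; under eq_Rintegral do rewrite -mulrA.
by rewrite RintegralZl//; apply: continuous_integrable_itv;
  exact: continuous_conv_integrand.
Qed.

Lemma convZr (a : R) f g t : continuous f -> continuous g ->
  conv f (fun r => a * g r) t = a * conv f g t.
Proof.
move=> cf cg; rewrite /conv; under eq_Rintegral do rewrite mulrCA.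
by rewrite RintegralZl//; apply: continuous_integrable_itv;
  exact: continuous_conv_integrand.
Qed.

(** Cutting [g] off on the negative axis moves the lower limit to some [a < 0]. Then [x], of
    whatever sign, is interior to [[a, b]], where continuity in the upper limit is available. *)
Lemma continuous_Rintegral0 g : continuous g ->
  continuous (fun x : R => \int[mu]_(r in `[0, x]) g r).
Proof.
move=> cg x; pose a := Num.min x 0 - 1; pose b := x + 1.
have ax : a < x by rewrite /a ltrBlDr gt_min ltrDl ltr01.
have a0 : a < 0 by rewrite /a ltrBlDr gt_min orbC ltrDl ltr01.
have xb : x < b by rewrite ltrDl.
have abE : (fun x : R => \int[mu]_(r in `[0, x]) g r) =
    (fun x : R => \int[mu]_(r in `[a, x]) (g \_ `[0, +oo[) r).
  apply/funext => y; rewrite -Rintegral_mkcondr; congr Rintegral.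
  apply/seteqP; split => r/=; rewrite !in_itv/= ?andbT.
    by move=> /andP[r0 ->]; rewrite r0 (le_trans (ltW a0)).
  by move=> [/andP[_ ->] ->].
rewrite abE.
have : {within `[a, b], continuous
    (fun x : R => \int[mu]_(r in `[a, x]) (g \_ `[0, +oo[) r)}.
  apply: parameterized_integral_continuous; first exact: ltW (lt_trans ax xb).
  rewrite -restrict_EFin; apply/integrable_restrict => //.
  apply: (@integrableS _ _ _ mu `[a, b]) => //.
  - exact: measurableI.
  - exact: continuous_integrable_itv.
move/continuous_within_itvP => /(_ (lt_trans ax xb))[+ _ _].
by apply; rewrite in_itv/= ax xb.
Qed.

(* Splitting off the constant [f 0] makes the remaining factor vanish for
   [t <= r], so that its integral may be taken over a fixed interval. *)
Lemma continuous_conv f g : continuous f -> continuous g -> continuous (conv f g).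
Proof.
move=> cf cg x; pose T := `|x| + 1.
have xT : x < T by rewrite ltr_pwDr// ler_norm.
have Tx : - T < x by rewrite ltrNl ltr_pwDr// -normrN ler_norm.
pose f0 y := f (clamp y) - f 0.
have cf0 : continuous f0.
  move=> y; apply: cvgB; last exact: cvg_cst.
  by apply: continuous_comp; [exact: continuous_clamp|exact: cf].
have f00 y : y <= 0 -> f0 y = 0 by rewrite /f0 => /clamp0 ->; rewrite subrr.
have convE y : y \in `]-T, T[ -> conv f g y =
    f 0 * (\int[mu]_(r in `[0, y]) g r) +
    \int[mu]_(r in `[0, T]) (f0 (y - r) * g r).
  rewrite in_itv/= => /andP[_ yT].
  rewrite -RintegralZl//; last exact: continuous_integrable_itv.
  have -> : \int[mu]_(r in `[0, T]) (f0 (y - r) * g r) =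
      \int[mu]_(r in `[0, y]) (f0 (y - r) * g r).
    rewrite [LHS](_ : _ = \int[mu]_(r in `[0, T])
      ((fun r => f0 (y - r) * g r) \_ `[0, y]) r).
      rewrite -Rintegral_mkcondr; congr Rintegral.
      by apply: setIidr; apply: subset_itvl; rewrite bnd_simp ltW.
    apply: eq_Rintegral => r; rewrite inE/= in_itv/= => /andP[r0 _].
    rewrite patchE; case: ifPn => //; rewrite notin_setE/= in_itv/= r0/=.
    by move/negP; rewrite -ltNge => /ltW yr; rewrite f00 ?mul0r// subr_le0.
  rewrite -RintegralD//.
  - apply: eq_Rintegral => r; rewrite inE/= in_itv/= => /andP[_ ry].
    rewrite /f0 clamp_id ?subr_ge0//; ring.
  - by apply: continuous_integrable_itv => r; apply: cvgM; [exact: cvg_cst|exact: cg].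
  - by apply: continuous_integrable_itv; exact: continuous_conv_integrand.
have xI : x \in `]-T, T[ by rewrite in_itv/= Tx.
rewrite /continuous_at (convE _ xI).
suff : (f 0 * (\int[mu]_(r in `[0, y]) g r) +
    \int[mu]_(r in `[0, T]) (f0 (y - r) * g r)) @[y --> x] -->
    f 0 * (\int[mu]_(r in `[0, x]) g r) +
    \int[mu]_(r in `[0, T]) (f0 (x - r) * g r).
  apply: cvg_trans; apply: near_eq_cvg; near=> y; rewrite convE//.
  near: y; exact: near_in_itvoo.
apply: cvgD.
  by apply: cvgM; [exact: cvg_cst|exact: continuous_Rintegral0].
(* For [y] in []-T, T[] and [r] in [[0, T]] the argument [y - r] stays in this interval, so
   [M * |g r|] dominates the integrand. *)
have [M M0 f0M] := continuous_itv_bounded (- (T + T)) (T + T) cf0.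
apply: (@continuity_under_integral R _ _ mu (fun y r => f0 (y - r) * g r)
   `[0, T] _ (-T) T _ _ (fun r => M * `|g r|)) => //.
- move=> y _; apply: continuous_integrable_itv; exact: continuous_conv_integrand.
- apply: aeW => r _ y _; apply: cvgM; last exact: cvg_cst.
  apply: (@continuous_comp _ _ _ (fun y => y - r) f0); last exact: cf0.
  by apply: cvgB; [exact: cvg_id|exact: cvg_cst].
- apply: continuous_integrable_itv => r.
  by apply: cvgM; [exact: cvg_cst|apply: cvg_norm; exact: cg].
- move=> y /=; rewrite in_itv/= => /andP[Ty yT]; apply: aeW => r /=.
  rewrite in_itv/= => /andP[r0 rT]; rewrite normrM ler_wpM2r// f0M//.
  by apply/andP; split; lra.
- by rewrite inE.
Unshelve. all: by end_near. Qed.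

End scalar_convolution.

(** * Fubini's theorem and associativity of scalar convolution *)

Lemma bounded_Fubini d1 d2 (T1 : measurableType d1) (T2 : measurableType d2)
    (R : realType) (m1 : {sigma_finite_measure set T1 -> \bar R})
    (m2 : {sigma_finite_measure set T2 -> \bar R}) (D1 : set T1) (D2 : set T2)
    (f : T1 * T2 -> R) (M : R) :
  measurable D1 -> measurable D2 -> (m1 D1 < +oo)%E -> (m2 D2 < +oo)%E ->
  measurable_fun setT f -> (forall p, `|f p| <= M) ->
  (forall p, ~ (D1 `*` D2) p -> f p = 0) ->
  (\int[m1]_x \int[m2]_y (f (x, y))%:E = \int[m2]_y \int[m1]_x (f (x, y))%:E)%E.
Proof.
move=> mD1 mD2 D1oo D2oo mf fM f0.
(* What remains is integrability for the product measure: the function is bounded and vanishes off a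
   rectangle of finite measure. *)
apply: (@Fubini _ _ _ _ _ m1 m2 (EFin \o f)).
have mD : measurable (D1 `*` D2) by exact: measurableX.
have -> : f = f \_ (D1 `*` D2).
  apply/funext => p; rewrite patchE; case: ifPn => //.
  by rewrite notin_setE => /f0.
rewrite -restrict_EFin; apply: (integrable_mkcond (EFin \o f) mD).1.
apply: measurable_bounded_integrable => //.
- by rewrite [ltLHS]product_measure1E// lte_mul_pinfty// ge0_fin_numE.
- exact: measurable_funS mf.
- exists M; split; first exact: num_real.
  by move=> x Mx p _ /=; apply: le_trans (ltW Mx).
Qed.

Section scalar_convolution_assoc.
Context {R : realType}.
Implicit Types (f g h : R -> R) (t : R).
Notation mu := (@lebesgue_measure R).

Lemma Rintegral_shift g (r t : R) : r <= t -> continuous g ->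
  \int[mu]_(s in `[r, t]) g s = \int[mu]_(u in `[0, t - r]) g (u + r).
Proof.
move=> rt cg.
have dF (x : R) : derivable (fun u : R => u + r) x 1 by [].
have F1 : derive1 (fun u : R => u + r) = cst 1.
  by apply/funext => x; rewrite derive1E deriveD// derive_id derive_cst addr0.
have cF (x : R) : (u + r) @[u --> x] --> x + r.
  by apply: cvgD; [exact: cvg_id|exact: cvg_cst].
have -> : [set` `[r, t]] = [set` `[0 + r, t - r + r]] by rewrite add0r subrK.
rewrite /Rintegral.
rewrite (@integration_by_substitution_increasing _ (fun u : R => u + r) g)//.
- congr fine; apply: eq_integral => x _; rewrite !fctE F1 /= mulr1//.
- by rewrite subr_ge0.
- by move=> x y _ _ xy; rewrite ltrD2r.
- by rewrite F1 => x _; exact: cvg_cst.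
- by rewrite F1; exact: is_cvg_cst.
- by rewrite F1; exact: is_cvg_cst.
- by split => //; [apply: cvg_at_right_filter; exact: cF|
                   apply: cvg_at_left_filter; exact: cF].
- exact: continuous_subspaceT.
Qed.

Lemma continuous_measurable2 f (a b : R * R -> R) :
  continuous f -> measurable_fun setT a -> measurable_fun setT b ->
  measurable_fun setT (fun p => f (a p - b p)).
Proof.
move=> cf ma mb; apply: (@measurableT_comp _ _ _ _ _ _ f).
  exact: continuous_measurable_fun.
exact: measurable_funB.
Qed.

(* Fubini on the triangle [0 <= r <= s <= t]. *)
Lemma convA f g h t : continuous f -> continuous g -> continuous h ->
  conv f (conv g h) t = conv (conv f g) h t.
Proof.
move=> cf cg ch; have [t0|t0] := leP t 0; first by rewrite !conv_le0.
(* [p.1] is the outer variable [s] of [conv f (conv g h)] and [p.2] the inner variable [r]; the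
   cut-off lets both iterated integrals run over the whole line. *)
pose T (p : R * R) := [&& 0 <= p.2, p.2 <= p.1 & p.1 <= t].
pose phi (p : R * R) : R :=
  if T p then f (t - p.1) * g (p.1 - p.2) * h p.2 else 0.
have mphi : measurable_fun setT phi.
  apply: measurable_fun_ifT => //=.
  - apply: measurable_and; first exact: measurable_fun_ler.
    by apply: measurable_and; exact: measurable_fun_ler.
  - apply: measurable_funM; last first.
      apply: (@measurableT_comp _ _ _ _ _ _ h) => //.
      exact: continuous_measurable_fun.
    by apply: measurable_funM; exact: continuous_measurable2.
have [Mf Mf0 fM] := continuous_itv_bounded 0 t cf.
have [Mg Mg0 gM] := continuous_itv_bounded 0 t cg.
have [Mh Mh0 hM] := continuous_itv_bounded 0 t ch.
have phiM p : `|phi p| <= Mf * Mg * Mh.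
  rewrite /phi /T; case: ifPn => [/and3P[p0 p21 p1t]|_].
    rewrite !normrM ler_pM// ?mulr_ge0// ?ler_pM// ?fM ?gM ?hM//.
    - by apply/andP; split; lra.
    - by apply/andP; split; lra.
    - by apply/andP; split; lra.
  by rewrite normr0 !mulr_ge0.
have mu0t : (mu `[0%R, t] < +oo)%E.
  by rewrite lebesgue_measure_itv/= lte_fin t0 -EFinD ltry.
have phi0 p : ~ (`[0, t]%classic `*` `[0, t]%classic) p -> phi p = 0.
  move=> pQ; rewrite /phi /T; case: ifP => // /and3P[p0 p21 p1t].
  exfalso; apply: pQ; rewrite /= !in_itv/=.
  by split; apply/andP; split => //; lra.
have := @bounded_Fubini _ _ (measurableTypeR R) (measurableTypeR R) R mu mu
  _ _ phi _ (measurable_itv `[0, t]) (measurable_itv `[0, t]) mu0t mu0t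
  mphi phiM phi0.
have -> : (fun s => \int[mu]_r (phi (s, r))%:E)%E =
    EFin \o ((fun s => f (t - s) * conv g h s) \_ `[0, t]).
  apply/funext => s /=; rewrite patchE; case: ifPn => [|].
    rewrite inE/= in_itv/= => /andP[s0 st].
    rewrite /conv -RintegralZl//; last first.
      by apply: continuous_integrable_itv; exact: continuous_conv_integrand.
    rewrite /Rintegral fineK; last first.
      apply: integrable_fin_num => //; apply: continuous_integrable_itv; move=> r.
      by apply: cvgM; [exact: cvg_cst|exact: continuous_conv_integrand].
    rewrite [RHS]integral_mkcond; apply: eq_integral => r _.
    rewrite patchE /phi /T/= st andbT mem_setE in_itv/=.
    by case: ifP => //; rewrite mulrA.
  rewrite notin_setE/= in_itv/= => /negP st.
  rewrite integral0_eq// => r _; rewrite /phi /T/=; case: ifP => // /and3P[r0 rs s1].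
  by move: st; rewrite (le_trans r0 rs) s1.
have -> : (fun r => \int[mu]_s (phi (s, r))%:E)%E =
    EFin \o ((fun r => conv f g (t - r) * h r) \_ `[0, t]).
  apply/funext => r /=; rewrite patchE; case: ifPn => [|].
    rewrite inE/= in_itv/= => /andP[r0 rt].
    (* For fixed [r] the variable [s] runs over [[r, t]]; the substitution [s = u + r] identifies
       this integral with the convolution at [t - r]. *)
    have -> : conv f g (t - r) = \int[mu]_(s in `[r, t]) (f (t - s) * g (s - r)).
      rewrite Rintegral_shift//; last first.
        move=> s; apply: cvgM; first exact: continuous_subr.
        apply: (@continuous_comp _ _ _ (fun s => s - r) g); last exact: cg.
        by apply: cvgB; [exact: cvg_id|exact: cvg_cst].
      by apply: eq_Rintegral => u _; rewrite addrK opprD addrA addrAC.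
    have ci : continuous (fun s => f (t - s) * g (s - r)).
      move=> s; apply: cvgM; first exact: continuous_subr.
      apply: (@continuous_comp _ _ _ (fun s => s - r) g); last exact: cg.
      by apply: cvgB; [exact: cvg_id|exact: cvg_cst].
    rewrite -RintegralZr//; last exact: continuous_integrable_itv.
    rewrite /Rintegral fineK; last first.
      apply: integrable_fin_num => //; apply: continuous_integrable_itv; move=> s.
      by apply: cvgM; [exact: ci|exact: cvg_cst].
    rewrite [RHS]integral_mkcond; apply: eq_integral => s _.
    rewrite patchE /phi /T/= r0 mem_setE in_itv/=.
    by case: ifP.
  rewrite notin_setE/= in_itv/= => /negP rt.
  rewrite integral0_eq// => s _; rewrite /phi /T/=; case: ifP => // /and3P[r0 rs s1].
  by move: rt; rewrite r0 (le_trans rs s1).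
move=> /(congr1 fine).
by move=> E; rewrite /conv [LHS]Rintegral_mkcond [RHS]Rintegral_mkcond; exact E.
Qed.

End scalar_convolution_assoc.

(** * Geometric majorants *)

Section geometric_majorant.
Context {R : realType}.
Implicit Types (u : nat -> R) (C : R).

Lemma sum_half_pow C (n m : nat) : (n <= m)%N ->
  \sum_(n <= l < m) C / 2 ^+ l = 2 * C / 2 ^+ n - 2 * C / 2 ^+ m.
Proof.
elim: m => [|m ih]; first by rewrite leqn0 => /eqP ->; rewrite big_geq// subrr.
rewrite leq_eqVlt => /predU1P[->|]; first by rewrite big_geq// subrr.
rewrite ltnS => nm; rewrite big_nat_recr//= ih// exprS.
have : (2 : R) ^+ m != 0 by rewrite expf_neq0.
by move=> h; field; rewrite h expf_neq0.
Qed.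

Lemma le_sum_half_pow C (n m : nat) : 0 <= C ->
  \sum_(n <= l < m) C / 2 ^+ l <= 2 * C / 2 ^+ n.
Proof.
move=> C0; have [nm|mn] := leqP n m.
  by rewrite sum_half_pow// lerBlDr lerDl divr_ge0 ?mulr_ge0 ?exprn_ge0.
by rewrite big_geq ?(ltnW mn)// divr_ge0 ?mulr_ge0 ?exprn_ge0.
Qed.

Variables (u : nat -> R) (C : R).
Hypothesis C0 : 0 <= C.
Hypothesis uC : forall l, (0 < l)%N -> `|u l| <= C / 2 ^+ l.

Lemma ler_norm_sum_half_pow (n m : nat) : (0 < n)%N ->
  \sum_(n <= l < m) `|u l| <= 2 * C / 2 ^+ n.
Proof.
move=> n0; apply: le_trans (le_sum_half_pow n m C0).
by rewrite !big_nat; apply: ler_sum => l /andP[nl _]; rewrite uC// (leq_trans n0).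
Qed.

Lemma half_pow_cvg_abs : cvgn (fun n => \sum_(1 <= l < n) `|u l|).
Proof.
apply: nondecreasing_is_cvgn.
  apply/nondecreasing_seqP => -[|n]; first by rewrite !big_geq.
  by rewrite [leRHS]big_nat_recr//= lerDl.
by exists (2 * C / 2 ^+ 1) => _ [n _ <-]; exact: ler_norm_sum_half_pow.
Qed.

Lemma half_pow_cvg : cvgn (fun n => \sum_(1 <= l < n) u l).
Proof.
(* A sum starting at 1 is the [series] of the shifted sequence, for which absolute convergence
   implies convergence. *)
have /normed_cvg/cvg_ex[l ul] : cvgn [normed series (fun k => u k.+1)].
  have /cvg_ex[l ul] := half_pow_cvg_abs; apply/cvg_ex; exists l => /=.
  move: ul; rewrite -[X in X -> _]cvg_shiftS /=; apply: cvg_trans.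
  by apply: near_eq_cvg; near=> n; rewrite /series/= big_add1.
apply/cvg_ex; exists l => /=; rewrite -cvg_shiftS /=; move: ul; apply: cvg_trans.
by apply: near_eq_cvg; near=> n; rewrite /series/= big_add1.
Unshelve. all: by end_near. Qed.

(** The bound on the blocks from [n] to [m] does not depend on [m], so it survives the limit in
    [m]. *)
Lemma half_pow_tail (n : nat) : (0 < n)%N ->
  `|limn (fun n => \sum_(1 <= l < n) u l) - \sum_(1 <= l < n) u l| <=
  2 * C / 2 ^+ n.
Proof.
move=> n0; set S := (fun n => _).
have : `|S m - S n| @[m --> \oo] --> `|limn S - S n|.
  by apply: cvg_norm; apply: cvgB; [exact: half_pow_cvg|exact: cvg_cst].
move=> /[dup]/cvgP cS /(cvg_lim (@Rhausdorff R)) <-.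
apply: limr_le => //; near=> m.
have nm : (n <= m)%N by near: m; exact: nbhs_infty_ge.
rewrite /S (big_cat_nat n0 nm)//= addrAC subrr add0r.
by apply: le_trans (ler_norm_sum _ _ _) _; exact: ler_norm_sum_half_pow.
Unshelve. all: by end_near. Qed.

End geometric_majorant.

Lemma cvg_half_pow (R : realType) (C : R) : C / 2 ^+ n @[n --> \oo] --> (0 : R).
Proof.
have -> : (fun n => C / 2 ^+ n) = geometric C 2^-1.
  by apply/funext => n; rewrite /geometric/= exprVn.
by apply: cvg_geometric; rewrite ger0_norm ?invr_ge0// invf_lt1// ltr1n.
Qed.

(** Weierstrass' M-test: the tail bound is the same at every point of [A]. *)
Lemma half_pow_uniform (R : realType) (T : choiceType) (A : set T)
    (u : nat -> T -> R) (C : R) : 0 <= C ->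
  (forall l x, (0 < l)%N -> A x -> `|u l x| <= C / 2 ^+ l) ->
  {uniform A, (fun n x => \sum_(1 <= l < n) u l x) @ \oo -->
    (fun x => limn (fun n => \sum_(1 <= l < n) u l x))}.
Proof.
move=> C0 uC P /uniform_nbhs[E [+ EP]]; rewrite -entourage_ballE => -[e /= e0 eE].
have := cvg_half_pow (2 * C) => /cvgr0_norm_lt/(_ _ e0) h.
near=> n; apply: EP => x Ax; apply: eE => /=.
rewrite /ball/=; apply: le_lt_trans (half_pow_tail C0 _ _) _.
- by move=> l l0; exact: uC.
- by near: n; exact: nbhs_infty_gt.
- by apply: le_lt_trans (ler_norm _) _; near: n.
Unshelve. all: by end_near. Qed.

(** * Bounds and differentiation of convolutions *)

Section scalar_convolution_bounds.
Context {R : realType}.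
Implicit Types (f g h : R -> R) (t : R).
Notation mu := (@lebesgue_measure R).

Lemma norm_Rintegral_le f g (a b : R) : continuous f -> continuous g ->
  (forall r, a <= r <= b -> `|f r| <= g r) ->
  `|\int[mu]_(r in `[a, b]) f r| <= \int[mu]_(r in `[a, b]) g r.
Proof.
move=> cf cg fg; apply: (le_trans (le_normr_Rintegral _ _)) => //.
  exact: continuous_integrable_itv.
apply: le_Rintegral => //.
- by apply: continuous_integrable_itv; move=> r; apply: cvg_norm; exact: cf.
- exact: continuous_integrable_itv.
Qed.

(** The factor [t], the length of the interval, is the source of the extra power of [t] in the final
    estimate. *)
Lemma conv_le f g (A B t : R) : continuous f -> continuous g -> 0 <= t ->
  (forall r : R, 0 <= r <= t -> `|f r| <= A) ->
  (forall r : R, 0 <= r <= t -> `|g r| <= B) ->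
  `|conv f g t| <= A * B * t.
Proof.
move=> cf cg t0 fA gB.
apply: (@le_trans _ _ (\int[mu]_(r in `[0, t]) (A * B))).
  apply: norm_Rintegral_le; first exact: continuous_conv_integrand.
    by move=> x; exact: cvg_cst.
  by move=> r /andP[r0 rt]; rewrite normrM ler_pM// ?fA ?gB ?r0//; apply/andP; split; lra.
rewrite Rintegral_cst//.
by have := @lebesgue_measure_itv R `[0, t] => /= ->; rewrite lte_fin;
  case: ltP => [_|/(conj t0)/andP/le_anti <-]; rewrite ?oppr0 ?addr0.
Qed.

Lemma continuous_expR_subr (l t : R) : continuous (fun r => expR (l * (t - r))).
Proof.
move=> r; apply: (@continuous_comp _ _ _ (fun r => l * (t - r)) expR).
  by apply: cvgM; [exact: cvg_cst|apply: cvgB; [exact: cvg_cst|exact: cvg_id]].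
exact: continuous_expR.
Qed.

Lemma Rintegral_expR_le (l t : R) : 0 < l -> 0 <= t ->
  \int[mu]_(r in `[0, t]) expR (l * (t - r)) <= expR (l * t) / l.
Proof.
move=> l0; rewrite le_eqVlt => /predU1P[<-|t0].
  by rewrite set_itv1 Rintegral_set1 divr_ge0// ?expR_ge0// ltW.
(* An antiderivative of the integrand. The integral equals [(expR (l * t) - 1) / l], of which the
   negative term is dropped. *)
pose F (r : R) := - (expR (l * (t - r)) / l).
have dF (r : R) : is_derive r 1 F (expR (l * (t - r))).
  have dp : is_derive r 1 (fun r => l * (t - r)) (- l).
    have -> : (fun r => l * (t - r)) = cst (l * t) - l *: id.
      by apply/funext => x; rewrite !fctE mulrBr.
    by apply: is_derive_eq; rewrite sub0r /GRing.scale/= mulr1.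
  have de := @is_derive1_comp R expR (fun r => l * (t - r)) r _ _ (is_derive_expR _) dp.
  have -> : F = - l^-1 *: (expR \o (fun r => l * (t - r))).
    by apply/funext => x; rewrite !fctE /F mulrC scaleNr.
  by apply: is_derive_eq; rewrite /GRing.scale/=; field; rewrite gt_eqF.
have cF : continuous F.
  by move=> r; apply/differentiable_continuous/derivable1_diffP; have [] := dF r.
rewrite /Rintegral (@continuous_FTC2 _ _ F)//.
- rewrite -EFinB/= /F subrr mulr0 expR0 subr0; have : 0 < l^-1 by rewrite invr_gt0.
  lra.
- apply: continuous_subspaceT; exact: continuous_expR_subr.
- split.
  + by move=> x _; have [] := dF x.
  + by apply: cvg_at_right_filter; exact: cF.
  + by apply: cvg_at_left_filter; exact: cF.
- by move=> x _; rewrite derive1E derive_val.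
Qed.

(** The weight on [f], evaluated at [t - r], integrates to at most [expR (l * t) / l]: the rate [l]
    is preserved and a factor [1 / l] is gained. *)
Lemma conv_expR_le f g (A B l t : R) : continuous f -> continuous g ->
  0 < l -> 0 <= t -> 0 <= A -> 0 <= B ->
  (forall r : R, 0 <= r <= t -> `|f r| <= A * expR (l * r)) ->
  (forall r : R, 0 <= r <= t -> `|g r| <= B) ->
  `|conv f g t| <= A * B / l * expR (l * t).
Proof.
move=> cf cg l0 t0 A0 B0 fA gB.
have ce := @continuous_expR_subr l t.
apply: (@le_trans _ _ (\int[mu]_(r in `[0, t]) ((A * B) * expR (l * (t - r))))).
  apply: norm_Rintegral_le; first exact: continuous_conv_integrand.
    by move=> x; apply: cvgM; [exact: cvg_cst|exact: ce].
  move=> r /andP[r0 rt]; rewrite normrM [leRHS]mulrAC.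
  by rewrite ler_pM// ?fA ?gB ?r0//; apply/andP; split; lra.
rewrite RintegralZl//; last exact: continuous_integrable_itv.
rewrite -[leRHS]mulrA ler_wpM2l ?mulr_ge0// [leRHS]mulrC.
exact: Rintegral_expR_le.
Qed.

(** Written as convolutions with the constant 1, primitives become subject to associativity. *)
Lemma conv1E f t : conv (cst 1) f t = \int[mu]_(r in `[0, t]) f r.
Proof. by apply: eq_Rintegral => r _; rewrite mul1r. Qed.

Lemma conv1_is_derive f t : continuous f -> 0 < t ->
  is_derive t 1 (conv (cst 1) f) (f t).
Proof.
move=> cf t0.
have [||df f'] := @continuous_FTC1_closed R f 0 t (t + 1) _ _ t0 (cf t).
- by rewrite ltrDl.
- exact: continuous_integrable_itv.
have -> : conv (cst 1) f = (fun t => \int[mu]_(r in `[0, t]) f r).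
  by apply/funext => x; exact: conv1E.
by split; [exact: df|rewrite -derive1E; exact: f'].
Qed.

(** Differentiability is required at positive times only, as for a parametrix; continuity of [f] and
    [d] carries the fundamental theorem of calculus down to 0. *)
Lemma conv1_derivative f d t : continuous f -> continuous d ->
  (forall t, 0 < t -> is_derive t 1 f (d t)) -> 0 <= t ->
  f t = f 0 + conv (cst 1) d t.
Proof.
move=> cf cd fd; rewrite le_eqVlt => /predU1P[<-|t0].
  by rewrite conv_le0// addr0.
rewrite conv1E /Rintegral (@continuous_FTC2 _ _ f)//.
- by rewrite -EFinB/= subrKC.
- exact: continuous_subspaceT.
- split.
  + by move=> x; rewrite in_itv/= => /andP[x0 _]; have [] := fd x x0.
  + by apply: cvg_at_right_filter; exact: cf.
  + by apply: cvg_at_left_filter; exact: cf.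
- move=> x; rewrite in_itv/= => /andP[x0 _]; have [_ <-] := fd x x0.
  by rewrite derive1E.
Qed.

End scalar_convolution_bounds.

(** * Convolution of kernels on the graph *)

Section finite_sums.
Context {R : realType} {I : Type}.
Implicit Types (s : seq I) (f : I -> R -> R).
Notation mu := (@lebesgue_measure R).

Lemma continuous_sumr s f : (forall i, continuous (f i)) ->
  continuous (fun t => \sum_(i <- s) f i t).
Proof.
move=> cf; elim: s => [|i s ih].
  by under eq_fun do rewrite big_nil; move=> t; exact: cvg_cst.
under eq_fun do rewrite big_cons.
by move=> t; apply: cvgD; [exact: cf|exact: ih].
Qed.

Lemma Rintegral_sumr s f (a b : R) : (forall i, continuous (f i)) ->
  \int[mu]_(r in `[a, b]) (\sum_(i <- s) f i r) =
  \sum_(i <- s) \int[mu]_(r in `[a, b]) f i r.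
Proof.
move=> cf; elim: s => [|i s ih].
  rewrite big_nil; under eq_Rintegral do rewrite big_nil.
  by rewrite Rintegral_cst ?mul0r.
rewrite big_cons -ih; under eq_Rintegral do rewrite big_cons.
rewrite RintegralD//; apply: continuous_integrable_itv; first exact: cf.
exact: continuous_sumr.
Qed.

Lemma is_derive_sumr s f (df : I -> R) (t : R) :
  (forall i, is_derive t 1 (f i) (df i)) ->
  is_derive t 1 (fun t => \sum_(i <- s) f i t) (\sum_(i <- s) df i).
Proof.
move=> fdf; elim: s => [|i s ih].
  rewrite big_nil (_ : (fun _ => _) = cst 0); first exact: is_derive_cst.
  by apply/funext => x; rewrite big_nil.
rewrite big_cons.
rewrite (_ : (fun t => _) = f i + (fun t => \sum_(i <- s) f i t)).
  exact: is_deriveD.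
by apply/funext => x; rewrite fctE big_cons.
Qed.

End finite_sums.

Section heat_convolution.
Context {R : realType} {G : weighted_graph R}.
Implicit Types (F H K P : heat_fun G) (v w : G) (t : R).
Notation mu := (@lebesgue_measure R).

(** Continuity in time over the whole real line; the vertex variables are discrete and impose no
    condition. *)
Definition hcontinuous F := forall v1 v2, continuous (F v1 v2).

Lemma eq_convolution F1 F1' F2 F2' v1 v2 t :
  (forall v1 v2 r, 0 <= r -> F1 v1 v2 r = F1' v1 v2 r) ->
  (forall v1 v2 r, 0 <= r -> F2 v1 v2 r = F2' v1 v2 r) ->
  convolution F1 F2 v1 v2 t = convolution F1' F2' v1 v2 t.
Proof.
move=> F11' F22'; apply: eq_Rintegral => r; rewrite inE/= in_itv/= => /andP[r0 rt].
by apply: eq_bigr => v _; rewrite F11' ?subr_ge0// F22'.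
Qed.

(** A matrix product over [G] in which entries are multiplied by [conv]; kernel statements reduce to
    scalar ones through it. *)
Lemma convolutionE F1 F2 v1 v2 t : hcontinuous F1 -> hcontinuous F2 ->
  convolution F1 F2 v1 v2 t = \sum_(v : G) conv (F1 v1 v) (F2 v v2) t.
Proof.
by move=> c1 c2; rewrite /convolution Rintegral_sumr// => v; exact: continuous_conv_integrand.
Qed.

Lemma convolution0 F1 F2 v1 v2 : convolution F1 F2 v1 v2 0 = 0.
Proof. by rewrite /convolution set_itv1 Rintegral_set1. Qed.

Lemma hcontinuous_convolution F1 F2 : hcontinuous F1 -> hcontinuous F2 ->
  hcontinuous (convolution F1 F2).
Proof.
move=> c1 c2 v1 v2.
have -> : convolution F1 F2 v1 v2 = fun t => \sum_(v : G) conv (F1 v1 v) (F2 v v2) t.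
  by apply/funext => t; exact: convolutionE.
by apply: continuous_sumr => v; exact: continuous_conv.
Qed.

Lemma hcontinuousD F1 F2 : hcontinuous F1 -> hcontinuous F2 ->
  hcontinuous (fun v1 v2 t => F1 v1 v2 t + F2 v1 v2 t).
Proof. by move=> c1 c2 v1 v2 t; apply: cvgD; [exact: c1|exact: c2]. Qed.

Lemma hcontinuousZ (a : R) F : hcontinuous F ->
  hcontinuous (fun v1 v2 t => a * F v1 v2 t).
Proof. by move=> c v1 v2 t; apply: cvgM; [exact: cvg_cst|exact: c]. Qed.

Lemma convolutionDr F1 F2 F3 v1 v2 t :
  hcontinuous F1 -> hcontinuous F2 -> hcontinuous F3 ->
  convolution F1 (fun v1 v2 t => F2 v1 v2 t + F3 v1 v2 t) v1 v2 t =
  convolution F1 F2 v1 v2 t + convolution F1 F3 v1 v2 t.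
Proof.
move=> c1 c2 c3; rewrite !convolutionE//; last exact: hcontinuousD.
by rewrite -big_split/=; apply: eq_bigr => v _; rewrite convDr.
Qed.

Lemma convolutionZr (a : R) F1 F2 v1 v2 t : hcontinuous F1 -> hcontinuous F2 ->
  convolution F1 (fun v1 v2 t => a * F2 v1 v2 t) v1 v2 t =
  a * convolution F1 F2 v1 v2 t.
Proof.
move=> c1 c2; rewrite !convolutionE//; last exact: hcontinuousZ.
by rewrite mulr_sumr; apply: eq_bigr => v _; rewrite convZr.
Qed.

Lemma convolutionDl F1 F2 F3 v1 v2 t :
  hcontinuous F1 -> hcontinuous F2 -> hcontinuous F3 ->
  convolution (fun v1 v2 t => F1 v1 v2 t + F2 v1 v2 t) F3 v1 v2 t =
  convolution F1 F3 v1 v2 t + convolution F2 F3 v1 v2 t.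
Proof.
move=> c1 c2 c3; rewrite !convolutionE//; last exact: hcontinuousD.
by rewrite -big_split/=; apply: eq_bigr => v _; rewrite convDl.
Qed.

Lemma convolutionZl (a : R) F1 F2 v1 v2 t : hcontinuous F1 -> hcontinuous F2 ->
  convolution (fun v1 v2 t => a * F1 v1 v2 t) F2 v1 v2 t =
  a * convolution F1 F2 v1 v2 t.
Proof.
move=> c1 c2; rewrite !convolutionE//; last exact: hcontinuousZ.
by rewrite mulr_sumr; apply: eq_bigr => v _; rewrite convZl.
Qed.

Lemma conv_sumr (f : R -> R) (g : G -> R -> R) t :
  continuous f -> (forall v, continuous (g v)) ->
  conv f (fun r => \sum_v g v r) t = \sum_v conv f (g v) t.
Proof.
move=> cf cg; rewrite /conv; under eq_Rintegral do rewrite mulr_sumr.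
by rewrite Rintegral_sumr// => v; exact: continuous_conv_integrand.
Qed.

Lemma conv_suml (f : G -> R -> R) (g : R -> R) t :
  (forall v, continuous (f v)) -> continuous g ->
  conv (fun r => \sum_v f v r) g t = \sum_v conv (f v) g t.
Proof.
move=> cf cg; rewrite /conv; under eq_Rintegral do rewrite mulr_suml.
by rewrite Rintegral_sumr// => v; exact: continuous_conv_integrand.
Qed.

Lemma convolutionA F1 F2 F3 :
  hcontinuous F1 -> hcontinuous F2 -> hcontinuous F3 ->
  convolution F1 (convolution F2 F3) = convolution (convolution F1 F2) F3.
Proof.
move=> c1 c2 c3; apply/funext => v1; apply/funext => v2; apply/funext => t.
rewrite !convolutionE//; try exact: hcontinuous_convolution.
transitivity (\sum_(v : G) \sum_(w : G) conv (F1 v1 v) (conv (F2 v w) (F3 w v2)) t).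
  apply: eq_bigr => v _.
  rewrite -conv_sumr//; last by move=> w; exact: continuous_conv.
  by apply: eq_conv => // r r0; rewrite convolutionE.
rewrite exchange_big/=; apply: eq_bigr => w _.
transitivity (conv (fun r => \sum_v conv (F1 v1 v) (F2 v w) r) (F3 w v2) t).
  rewrite conv_suml//; last by move=> v; exact: continuous_conv.
  by apply: eq_bigr => v _; rewrite convA.
by apply: eq_conv => // r r0; rewrite convolutionE.
Qed.

Lemma hcontinuous_bounded F (T : R) : hcontinuous F ->
  exists2 C : R, 0 <= C &
    forall v1 v2 t, 0 <= t <= T -> `|F v1 v2 t| <= C.
Proof.
move=> cF.
have /choice[M MP] (p : G * G) : exists M : R, 0 <= M /\
    forall t : R, 0 <= t <= T -> `|F p.1 p.2 t| <= M.
  by have [M M0 FM] := continuous_itv_bounded 0 T (cF p.1 p.2); exists M.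
(* The sum of the finitely many nonnegative bounds serves as a common bound. *)
exists (\sum_p M p); first by apply: sumr_ge0 => p _; have [] := MP p.
move=> v1 v2 t t0T; rewrite (bigD1 (v1, v2))//=.
apply: (le_trans ((MP (v1, v2)).2 _ t0T)); rewrite lerDl.
by apply: sumr_ge0 => p _; have [] := MP p.
Qed.

Lemma convolution_le F1 F2 (A B t : R) v1 v2 :
  hcontinuous F1 -> hcontinuous F2 -> 0 <= t ->
  (forall v1 v2 r, 0 <= r <= t -> `|F1 v1 v2 r| <= A) ->
  (forall v1 v2 r, 0 <= r <= t -> `|F2 v1 v2 r| <= B) ->
  `|convolution F1 F2 v1 v2 t| <= #|G|%:R * (A * B * t).
Proof.
move=> c1 c2 t0 F1A F2B; rewrite convolutionE//.
apply: le_trans (ler_norm_sum _ _ _) _.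
apply: (@le_trans _ _ (\sum_(v : G) A * B * t)).
  by apply: ler_sum => v _; apply: conv_le => // r; [exact: F1A|exact: F2B].
by rewrite sumr_const mulr_natl.
Qed.

Lemma convolution_expR_le F1 F2 (A B l t : R) v1 v2 :
  hcontinuous F1 -> hcontinuous F2 -> 0 < l -> 0 <= t -> 0 <= A -> 0 <= B ->
  (forall v1 v2 r, 0 <= r <= t -> `|F1 v1 v2 r| <= A * expR (l * r)) ->
  (forall v1 v2 r, 0 <= r <= t -> `|F2 v1 v2 r| <= B) ->
  `|convolution F1 F2 v1 v2 t| <= #|G|%:R * (A * B / l * expR (l * t)).
Proof.
move=> c1 c2 l0 t0 A0 B0 F1A F2B; rewrite convolutionE//.
apply: le_trans (ler_norm_sum _ _ _) _.
apply: (@le_trans _ _ (\sum_(v : G) A * B / l * expR (l * t))).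
  by apply: ler_sum => v _; apply: conv_expR_le => // r; [exact: F1A|exact: F2B].
by rewrite sumr_const mulr_natl.
Qed.

End heat_convolution.

(** * The Neumann series *)

Section resolvent.
Context {R : realType} {G : weighted_graph R}.
Implicit Types (P : heat_fun G) (t : R).

Lemma convolution_powS P l :
  convolution_pow P l.+2 = convolution (convolution_pow P l.+1) P.
Proof. by []. Qed.

Lemma hcontinuous_pow P l : hcontinuous P -> hcontinuous (convolution_pow P l).
Proof.
move=> cP; case: l => [//|l]; elim: l => [//|l ih].
by rewrite convolution_powS; exact: hcontinuous_convolution.
Qed.

(** The powers are defined by multiplication on the right; associativity moves the new factor to the
    left, as the recursion for the partial sums requires. *)
Lemma convolution_powSl P l : hcontinuous P ->
  convolution_pow P l.+2 = convolution P (convolution_pow P l.+1).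
Proof.
move=> cP; elim: l => [//|l ih]; rewrite convolution_powS {1}ih -convolutionA//.
exact: hcontinuous_pow.
Qed.

Lemma eq_convolution_pow P P' l :
  (forall v1 v2 t, 0 <= t -> P v1 v2 t = P' v1 v2 t) ->
  forall v1 v2 t, 0 <= t ->
    convolution_pow P l v1 v2 t = convolution_pow P' l v1 v2 t.
Proof.
move=> PP'; case: l => [//|l]; elim: l => [//|l ih] v1 v2 t t0.
by rewrite !convolution_powS; exact: eq_convolution.
Qed.

(* Weighting by [expR (a * t)] with [a] large makes convolution with [P] a
   contraction with ratio 1/2, so that a geometric series is a majorant. *)
Lemma convolution_pow_le P (T : R) : hcontinuous P ->
  exists2 C : R, 0 <= C & forall l v1 v2 t, (0 < l)%N -> 0 <= t <= T ->
    `|convolution_pow P l v1 v2 t| <= C / 2 ^+ l.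
Proof.
move=> cP; have [C C0 PC] := hcontinuous_bounded T cP.
(* Each convolution multiplies the constant by [#|G| * C / a], which is at most 1/2; the summand 1
   keeps [a] positive when [C = 0] or [G] is empty. *)
pose a : R := 2 * #|G|%:R * C + 1.
have a0 : 0 < a by rewrite ltr_wpDl// !mulr_ge0.
have powC l : forall v1 v2 t, 0 <= t <= T ->
    `|convolution_pow P l.+1 v1 v2 t| <= C / 2 ^+ l * expR (a * t).
  elim: l => [|l ih] v1 v2 t /andP[t0 tT].
    rewrite expr0 divr1; apply: (@le_trans _ _ C); first by apply: PC; rewrite t0.
    by rewrite ler_peMr// -expR0 ler_expR mulr_ge0// ltW.
  rewrite convolution_powS.
  apply: (@le_trans _ _ (#|G|%:R * (C / 2 ^+ l * C / a * expR (a * t)))).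
    apply: convolution_expR_le => //.
    - exact: hcontinuous_pow.
    - by rewrite divr_ge0// exprn_ge0.
    - by move=> w1 w2 r /andP[r0 rt]; apply: ih; rewrite r0 (le_trans rt).
    - by move=> w1 w2 r /andP[r0 rt]; apply: PC; rewrite r0 (le_trans rt).
  rewrite !mulrA ler_wpM2r ?expR_ge0// ler_pdivrMr// exprS invfM.
  have /= h : 0 <= C / 2 ^+ l by rewrite divr_ge0// exprn_ge0.
  rewrite [leRHS](_ : _ = C / 2 ^+ l * (2^-1 * a)); last by ring.
  rewrite [leLHS](_ : _ = C / 2 ^+ l * (#|G|%:R * C)); last by ring.
  by rewrite ler_wpM2l// /a; lra.
(* The factor 2 compensates the index shift in [powC], where the power [l.+1] is bounded with
   [2 ^+ l]; [expR (a * T)] absorbs the weight on [[0, T]]. *)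
exists (2 * C * expR (a * T)).
  by rewrite !mulr_ge0// expR_ge0.
move=> [//|l] v1 v2 t _ /andP[t0 tT].
apply: (le_trans (powC _ _ _ _ _)); first by rewrite t0.
rewrite exprS invfM [leRHS](_ : _ = C / 2 ^+ l * expR (a * T)); last by field; rewrite expf_neq0.
by rewrite ler_wpM2l ?divr_ge0 ?exprn_ge0// ler_expR ler_pM2l.
Qed.

(** The counterpart of [neumann_term] for an arbitrary kernel [P]: [heat_op_ext H] is uncontrolled
    at negative times and will be replaced by a continuous kernel. *)
Definition resolvent_term P l : heat_fun G := fun v1 v2 t =>
  (-1) ^+ l * convolution_pow P l v1 v2 t.

Definition resolvent_sum P n : heat_fun G := fun v1 v2 t =>
  \sum_(1 <= l < n) resolvent_term P l v1 v2 t.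

(** The solution of the Volterra equation [F = - P - P * F]. Through the clamp, bounds on [[0, T]]
    control the values at every [t <= T], which gives continuity on the whole line. *)
Definition resolvent P : heat_fun G := fun v1 v2 t =>
  limn (fun n => resolvent_sum P n v1 v2 (clamp t)).

Lemma resolvent_term_le P (T : R) : hcontinuous P ->
  exists2 C : R, 0 <= C & forall l v1 v2 t, (0 < l)%N -> 0 <= t <= T ->
    `|resolvent_term P l v1 v2 t| <= C / 2 ^+ l.
Proof.
move=> cP; have [C C0 PC] := convolution_pow_le T cP; exists C => // l v1 v2 t l0 tT.
by rewrite /resolvent_term normrM normrX normrN1 expr1n mul1r PC.
Qed.

Lemma hcontinuous_sum P n : hcontinuous P -> hcontinuous (resolvent_sum P n).
Proof.
move=> cP v1 v2; apply: continuous_sumr => l; apply: hcontinuousZ.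
exact: hcontinuous_pow.
Qed.

Lemma resolvent_sum_cvg P v1 v2 t : hcontinuous P -> 0 <= t ->
  resolvent_sum P n v1 v2 t @[n --> \oo] --> resolvent P v1 v2 t.
Proof.
move=> cP t0; have [C C0 PC] := resolvent_term_le t cP.
rewrite /resolvent clamp_id//.
by apply: (half_pow_cvg C0) => l l0; apply: PC; rewrite ?t0/=.
Qed.

Lemma resolvent_tail P (T : R) : hcontinuous P ->
  exists2 C : R, 0 <= C & forall n v1 v2 t, (0 < n)%N -> 0 <= t <= T ->
    `|resolvent P v1 v2 t - resolvent_sum P n v1 v2 t| <= C / 2 ^+ n.
Proof.
move=> cP; have [C C0 PC] := resolvent_term_le T cP.
exists (2 * C); first by rewrite mulr_ge0.
move=> n v1 v2 t n0 /andP[t0 tT]; rewrite /resolvent clamp_id//.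
by apply: half_pow_tail => // l l0; apply: PC; rewrite ?t0.
Qed.

(** A uniform limit of continuous functions on [t <= T], with [T] chosen so that this set is a
    neighbourhood of [x]. *)
Lemma hcontinuous_resolvent P : hcontinuous P -> hcontinuous (resolvent P).
Proof.
move=> cP v1 v2 x; pose T := `|x| + 1.
have [C C0 PC] := resolvent_tail T cP.
have cS n : continuous (fun t => resolvent_sum P n v1 v2 (clamp t)).
  move=> t; apply: (@continuous_comp _ _ _ clamp); first exact: continuous_clamp.
  exact: hcontinuous_sum.
have SE n t : (0 < n)%N -> t <= T ->
    `|resolvent P v1 v2 t - resolvent_sum P n v1 v2 (clamp t)| <= C / 2 ^+ n.
  move=> n0 tT; have -> : resolvent P v1 v2 t = resolvent P v1 v2 (clamp t).
    by rewrite /resolvent [in RHS]clamp_id// clamp_ge0.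
  apply: PC => //; rewrite clamp_ge0/= ge_max tT/= /T.
  by rewrite addr_ge0.
apply/cvgrPdist_lt => e e0.
have e3 : 0 < e / 3 by rewrite divr_gt0.
have [n n0 Cn] : exists2 n, (0 < n)%N & C / 2 ^+ n < e / 3.
  have /cvgr0_norm_lt/(_ _ e3) h := cvg_half_pow C.
  near \oo%classic => n; exists n; first by near: n; exact: nbhs_infty_gt.
  by apply: le_lt_trans (ler_norm _) _; near: n.
have /cvgrPdist_lt/(_ _ e3) cSn := cS n x.
have xltT : x < T by rewrite /T ltr_pwDr// ler_norm.
near=> y.
have yT : y <= T by apply: ltW; near: y; exact: lt_nbhsl.
have xT : x <= T by exact: ltW.
have h1 := SE n x n0 xT; have h2 := SE n y n0 yT.
have h3 : `|resolvent_sum P n v1 v2 (clamp x) - resolvent_sum P n v1 v2 (clamp y)| < e / 3.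
  by near: y.
set a := resolvent P v1 v2 x in h1 *; set b := resolvent P v1 v2 y in h2 *.
set a' := resolvent_sum _ _ _ _ _ in h1 h3; set b' := resolvent_sum _ _ _ _ _ in h2 h3.
rewrite (_ : a - b = (a - a') + (a' - b') - (b - b')); last by ring.
apply: (le_lt_trans (ler_normB _ _)); apply: (@le_lt_trans _ _ (C / 2 ^+ n + e / 3 + C / 2 ^+ n)).
  by apply: lerD => //; apply: (le_trans (ler_normD _ _)); apply: lerD => //; exact: ltW.
lra.
Unshelve. all: by end_near. Qed.

(** The Volterra equation holds exactly for partial sums, with one term fewer under the
    convolution. *)
Lemma resolvent_sumS P n v1 v2 t : hcontinuous P ->
  resolvent_sum P n.+2 v1 v2 t =
  - P v1 v2 t - convolution P (resolvent_sum P n.+1) v1 v2 t.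
Proof.
move=> cP; elim: n => [|n ih].
  rewrite {1}/resolvent_sum big_nat1 /resolvent_term expr1 mulN1r.
  (* The empty sum is written as [0 * P] so that homogeneity makes its convolution vanish. *)
  rewrite (_ : resolvent_sum P 1 = fun v1 v2 t => 0 * P v1 v2 t).
    by rewrite convolutionZr// mul0r subr0.
  apply/funext => w1; apply/funext => w2; apply/funext => r.
  by rewrite /resolvent_sum big_geq// mul0r.
rewrite {1}/resolvent_sum big_nat_recr//= -/(resolvent_sum P n.+2 v1 v2 t) ih.
have -> : resolvent_sum P n.+2 = fun v1 v2 t =>
    resolvent_sum P n.+1 v1 v2 t + (-1) ^+ n.+1 * convolution_pow P n.+1 v1 v2 t.
  apply/funext => w1; apply/funext => w2; apply/funext => r.
  by rewrite {1}/resolvent_sum big_nat_recr.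
have cS := @hcontinuous_sum P n.+1 cP; have cp := @hcontinuous_pow P n.+1 cP.
rewrite convolutionDr//; last exact: hcontinuousZ.
rewrite convolutionZr// -convolution_powSl// /resolvent_term [in LHS]exprS.
by ring.
Qed.

(** The limit of [resolvent_sumS]: the tail bound is uniform on [[0, t]], so the limit may be taken
    inside the convolution. *)
Lemma resolvent_eq P v1 v2 t : hcontinuous P -> 0 <= t ->
  resolvent P v1 v2 t = - P v1 v2 t - convolution P (resolvent P) v1 v2 t.
Proof.
move=> cP t0; have [A A0 PA] := hcontinuous_bounded t cP.
have [C C0 PC] := resolvent_tail t cP.
have cF := hcontinuous_resolvent cP.
have cS n := @hcontinuous_sum P n cP.
have cPS : convolution P (resolvent_sum P n.+1) v1 v2 t @[n --> \oo] -->
    convolution P (resolvent P) v1 v2 t.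
  apply/cvgrPdist_lt => e e0.
  have : #|G|%:R * (A * C * t) / 2 ^+ n @[n --> \oo] --> (0 : R) by exact: cvg_half_pow.
  move=> /cvgr0_norm_lt/(_ _ e0) h; near=> n.
  have -> : convolution P (resolvent P) v1 v2 t -
      convolution P (resolvent_sum P n.+1) v1 v2 t =
      convolution P (fun v1 v2 t =>
        resolvent P v1 v2 t + -1 * resolvent_sum P n.+1 v1 v2 t) v1 v2 t.
    by rewrite convolutionDr ?convolutionZr ?mulN1r//; exact: hcontinuousZ.
  apply: (@le_lt_trans _ _ (#|G|%:R * (A * (C / 2 ^+ n.+1) * t))).
    apply: convolution_le => //; first by apply: hcontinuousD => //; exact: hcontinuousZ.
    by move=> w1 w2 r rt; rewrite mulN1r PC.
  apply: (@le_lt_trans _ _ (#|G|%:R * (A * C * t) / 2 ^+ n)).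
    rewrite -!mulrA ler_wpM2l// ler_wpM2l// ler_wpM2l// mulrC ler_wpM2l//.
    by rewrite lef_pV2 ?posrE ?exprn_gt0// ler_eXn2l// ltr1n.
  by apply: le_lt_trans (ler_norm _) _; near: n.
have := @resolvent_sum_cvg P v1 v2 t cP t0; rewrite -2!cvg_shiftS /= => lhs.
apply: (cvg_unique (@Rhausdorff R) lhs).
rewrite (_ : (fun n => _) = fun n =>
    - P v1 v2 t - convolution P (resolvent_sum P n.+1) v1 v2 t).
  by apply: cvgB => //; exact: cvg_cst.
by apply/funext => n; exact: resolvent_sumS.
Unshelve. all: by end_near. Qed.

End resolvent.

(** * Uniqueness for the heat equation *)

Section heat_kernel_uniqueness.
Context {R : realType} {G : weighted_graph R}.
Implicit Types (F H K P : heat_fun G) (t : R).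

(** Symmetrising in [x] and [y] turns twice the sum into the Dirichlet form with terms
    [(f x - f y) ^+ 2 * weight x y]. *)
Lemma laplacian_energy_ge0 (f : G -> R) : 0 <= \sum_x f x * laplacian f x.
Proof.
pose E := \sum_x \sum_y f x * ((f x - f y) * weight x y).
have E1 : \sum_x f x * laplacian f x = E.
  by apply: eq_bigr => x _; rewrite /laplacian mulr_sumr.
have E2 : E = \sum_x \sum_y f y * ((f y - f x) * weight x y).
  rewrite /E exchange_big/=; apply: eq_bigr => x _; apply: eq_bigr => y _.
  by rewrite weight_sym.
have : 0 <= E + E.
  rewrite {1}E2 /E -big_split/=; apply: sumr_ge0 => x _.
  rewrite -big_split/=; apply: sumr_ge0 => y _.
  rewrite (_ : _ + _ = (f x - f y) ^+ 2 * weight x y); last by ring.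
  by rewrite mulr_ge0 ?sqr_ge0 ?weight_ge0.
by rewrite E1; lra.
Qed.

Lemma heat_op_eq0 F v1 v2 t : derivable (F v1 v2) t 1 -> heat_op F v1 v2 t = 0 ->
  is_derive t 1 (F v1 v2) (- laplacian (fun v => F v v2 t) v1).
Proof.
move=> dF /eqP; rewrite /heat_op addrC addr_eq0 => /eqP <-.
by rewrite derive1E; exact/derivableP.
Qed.

Lemma is_derive_continuous (f : R -> R) (t d : R) :
  is_derive t 1 f d -> {for t, continuous f}.
Proof.
by move=> [df _]; apply/differentiable_continuous/derivable1_diffP.
Qed.

(* The energy of the difference is nonincreasing and vanishes at [0]. *)
Lemma heat_eq_unique K1 K2 v1 v2 t : solves_heat_eq K1 -> solves_heat_eq K2 ->
  0 <= t -> K1 v1 v2 t = K2 v1 v2 t.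
Proof.
move=> [d1 e1 i1] [d2 e2 i2] t0.
pose d x t := K1 x v2 t - K2 x v2 t.
have dd x (s : R) : 0 < s -> is_derive s 1 (d x) (- laplacian (d^~ s) x).
  move=> s0; rewrite (_ : - _ = - laplacian (fun v => K1 v v2 s) x -
      - laplacian (fun v => K2 v v2 s) x).
    by apply: is_deriveB; apply: heat_op_eq0; auto.
  rewrite -opprD /laplacian -sumrB; congr (- _).
  by apply: eq_bigr => y _; rewrite /d; ring.
pose E t := \sum_x d x t ^+ 2.
have dE (s : R) : 0 < s -> is_derive s 1 E (- 2 * \sum_x d x s * laplacian (d^~ s) x).
  move=> s0; rewrite mulr_sumr; apply: is_derive_sumr => x.
  have := dd x s s0 => {}dd.
  have -> : (fun t => d x t ^+ 2) = d x ^+ 2 by apply/funext => r; rewrite expr2.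
  by apply: is_derive_eq; rewrite /GRing.scale/=; ring.
have d0 x : d x 0 = 0 by rewrite /d (i1 x v2).1 (i2 x v2).1 subrr.
have E0 : E 0 = 0.
  by rewrite /E big1// => x _; rewrite d0 expr0n.
(* Differentiability gives continuity at positive times only; at 0 the limits in [dirac_initial]
   provide it. *)
have cE : {within `[0, +oo[, continuous E}.
  apply/continuous_within_itvcyP; split.
    move=> x; rewrite in_itv/= andbT => x0.
    exact: is_derive_continuous (dE x x0).
  rewrite E0.
  suff : E r @[r --> 0^'+] --> \sum_(x : G) (0 : R) by rewrite big1.
  apply: cvg_big => [|x _]; first exact: add_continuous.
  have dx0 : d x r @[r --> 0^'+] --> 0.
    by have := cvgB (i1 x v2).2 (i2 x v2).2; rewrite subrr; exact.
  by have := cvgM dx0 dx0; rewrite mulr0; exact.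
have Et : E t <= 0.
  rewrite -E0; apply: (ler0_derive1_nincry _ _ cE) => //.
    by move=> x; rewrite in_itv/= andbT => x0; have [] := dE x x0.
  move=> x; rewrite in_itv/= andbT => x0; have [_ ] := dE x x0.
  rewrite derive1E => ->; rewrite mulNr oppr_le0 mulr_ge0//.
  exact: laplacian_energy_ge0.
have : d v1 t ^+ 2 <= 0.
  apply: le_trans Et; rewrite /E (bigD1 v1)//= lerDl.
  by apply: sumr_ge0 => x _; exact: sqr_ge0.
rewrite le_eqVlt ltNge sqr_ge0 orbF sqrf_eq0 subr_eq0 => /eqP.
exact.
Qed.

(** [heat_kernel] is a choice with a default value; the given [K] shows that there is something to
    choose, so the chosen function is a solution and uniqueness applies. *)
Lemma heat_kernel_eq K v1 v2 t : solves_heat_eq K -> 0 <= t ->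
  heat_kernel G v1 v2 t = K v1 v2 t.
Proof.
move=> sK t0; apply: heat_eq_unique => //.
by rewrite /heat_kernel; apply: (@xgetI _ _ [set K | solves_heat_eq K] K).
Qed.

End heat_kernel_uniqueness.

(** * Correcting a parametrix *)

Section duhamel.
Context {R : realType} {G : weighted_graph R}.
Implicit Types (F H K P : heat_fun G) (t : R).

Definition hlaplacian F : heat_fun G := fun v1 v2 t => laplacian (fun v => F v v2 t) v1.

Lemma hcontinuous_laplacian F : hcontinuous F -> hcontinuous (hlaplacian F).
Proof.
move=> cF v1 v2; apply: continuous_sumr => y t; apply: cvgM; last exact: cvg_cst.
by apply: cvgB; exact: cF.
Qed.

(** The Laplacian is a finite linear combination in the first vertex, and convolution is linear in
    its left factor. *)
Lemma convolution_laplacian F1 F2 v1 v2 t : hcontinuous F1 -> hcontinuous F2 ->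
  convolution (hlaplacian F1) F2 v1 v2 t = hlaplacian (convolution F1 F2) v1 v2 t.
Proof.
move=> c1 c2; rewrite convolutionE//; last exact: hcontinuous_laplacian.
transitivity (\sum_(v : G) \sum_(y : G)
    (conv (F1 v1 v) (F2 v v2) t - conv (F1 y v) (F2 v v2) t) * weight v1 y).
  apply: eq_bigr => v _; rewrite [LHS]conv_suml//.
    apply: eq_bigr => y _.
    transitivity (conv (fun r => weight v1 y * (F1 v1 v r + -1 * F1 y v r)) (F2 v v2) t).
      by apply: eq_conv => // r _; ring.
    have cN : continuous (fun r => -1 * F1 y v r).
      by move=> r; apply: cvgM; [exact: cvg_cst|exact: c1].
    rewrite convZl//; last by move=> r; apply: cvgD; [exact: c1|exact: cN].
    by rewrite convDl// convZl//; ring.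
  move=> y r; apply: cvgM; last exact: cvg_cst.
  by apply: cvgB; exact: c1.
rewrite exchange_big/=; apply: eq_bigr => y _.
by rewrite -mulr_suml sumrB !convolutionE.
Qed.

(* As [H = H 0 + 1 * D], associativity gives [H * F = 1 * (F + D * F)], so that
   no derivative has to be taken under the integral sign. *)
Lemma parametrix_convolution_eq (H D F : heat_fun G) v1 v2 t :
  hcontinuous H -> hcontinuous D -> hcontinuous F ->
  (forall v1 v2 t, 0 < t -> is_derive t 1 (H v1 v2) (D v1 v2 t)) ->
  (forall v1 v2, H v1 v2 0 = (v1 == v2)%:R) ->
  convolution H F v1 v2 t =
  conv (cst 1) (fun t => F v1 v2 t + convolution D F v1 v2 t) t.
Proof.
move=> cH cD cF dH H0.
have c1 : continuous (cst 1 : R -> R) by move=> ?; exact: cvg_cst.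
have c1D u v : continuous (conv (cst 1) (D u v)) by exact: continuous_conv.
rewrite convDr//; last exact: hcontinuous_convolution.
rewrite convolutionE//.
transitivity (\sum_v ((v1 == v)%:R * conv (cst 1) (F v v2) t +
                      conv (cst 1) (conv (D v1 v) (F v v2)) t)).
  apply: eq_bigr => v _.
  transitivity (conv (fun r => (v1 == v)%:R * cst 1 r + conv (cst 1) (D v1 v) r) (F v v2) t).
    apply: eq_conv => // r r0.
    by rewrite mulr1 -H0 (conv1_derivative (cH v1 v) (cD v1 v) (dH v1 v) r0).
  rewrite convDl//; last by move=> r; apply: cvgM; exact: cvg_cst.
  by rewrite convZl// convA.
rewrite big_split/=; congr (_ + _).
  (* [H] at time 0 is the identity matrix, so only [v = v1] contributes. *)
  rewrite (bigD1 v1)//= eqxx mul1r big1 ?addr0// => v /negbTE.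
  by rewrite eq_sym => ->; rewrite mul0r.
rewrite -conv_sumr//; last by move=> v; exact: continuous_conv.
by apply: eq_conv => // r r0; rewrite convolutionE.
Qed.

Lemma parametrix_solves (H P : heat_fun G) :
  hcontinuous H -> hcontinuous P ->
  (forall v1 v2 t, 0 < t ->
    is_derive t 1 (H v1 v2) (P v1 v2 t - hlaplacian H v1 v2 t)) ->
  (forall v1 v2, H v1 v2 0 = (v1 == v2)%:R) ->
  solves_heat_eq (fun v1 v2 t => H v1 v2 t + convolution H (resolvent P) v1 v2 t).
Proof.
move=> cH cP dH H0.
pose F := resolvent P; have cF : hcontinuous F by exact: hcontinuous_resolvent.
(* The time derivative of [H], continuous up to 0; the form [-1 *] fits the linearity lemmas. *)
pose D : heat_fun G := fun v1 v2 t => P v1 v2 t + -1 * hlaplacian H v1 v2 t.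
have cL := hcontinuous_laplacian cH.
have cD : hcontinuous D by apply: hcontinuousD => //; exact: hcontinuousZ.
have dHD v1 v2 t : 0 < t -> is_derive t 1 (H v1 v2) (D v1 v2 t).
  by move=> t0; rewrite /D mulN1r; exact: dH.
pose K : heat_fun G := fun v1 v2 t => H v1 v2 t + convolution H F v1 v2 t.
have cK : hcontinuous K by apply: hcontinuousD => //; exact: hcontinuous_convolution.
have dK v1 v2 t : 0 < t -> is_derive t 1 (K v1 v2) (- hlaplacian K v1 v2 t).
  move=> t0.
  have -> : K v1 v2 = H v1 v2 +
      conv (cst 1) (fun t => F v1 v2 t + convolution D F v1 v2 t).
    apply/funext => r; rewrite fctE /K; congr (_ + _).
    exact: parametrix_convolution_eq.
  have cFD : continuous (fun t => F v1 v2 t + convolution D F v1 v2 t).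
    by apply: hcontinuousD => //; exact: hcontinuous_convolution.
  have d1 := conv1_is_derive cFD t0; have d2 := dHD v1 v2 t t0.
  (* The derivative found is [D + F + D * F]. Expanding [D] and replacing the single [F] by
     [- P - P * F] cancels every [P] and leaves minus the Laplacian of [H + H * F]. *)
  apply: is_derive_eq.
  rewrite {2}/D convolutionDl//; last exact: hcontinuousZ.
  rewrite convolutionZl// convolution_laplacian// {1}/F resolvent_eq//; last exact: ltW.
  rewrite /D (_ : hlaplacian K v1 v2 t =
    hlaplacian H v1 v2 t + hlaplacian (convolution H F) v1 v2 t); first by ring.
  by rewrite /hlaplacian /laplacian -big_split/=; apply: eq_bigr => y _; rewrite /K; ring.
split.
- by move=> v1 v2 t t0; have [] := dK v1 v2 t t0.
- move=> v1 v2 t t0; have [_] := dK v1 v2 t t0.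
  by rewrite /heat_op derive1E => ->; rewrite subrr.
- have K0 v1 v2 : K v1 v2 0 = (v1 == v2)%:R by rewrite /K convolution0 addr0.
  move=> v1 v2; split; first exact: K0.
  by rewrite -K0; apply: cvg_at_right_filter; exact: cK.
Qed.

End duhamel.

(** * Clamped parametrices and estimates as [t] tends to 0 *)

Section parametrix.
Context {R : realType} {G : weighted_graph R}.
Implicit Types (F H K P : heat_fun G) (t : R).

(* Only times [t >= 0] matter; clamping makes continuity on [0, +oo[ continuity
   on the whole line. *)
Definition hclamp F : heat_fun G := fun v1 v2 t => F v1 v2 (clamp t).

(** The path sending [s] to [(v1, v2, clamp s)] is continuous and never leaves [time_ge0], so
    continuity within that set suffices. *)
Lemma hcontinuous_hclamp F :
  {within time_ge0 G, continuous (on_spacetime F)} -> hcontinuous (hclamp F).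
Proof.
move=> /subspace_continuousP cF v1 v2 t.
pose p (s : R) : spacetime R G := (v1, v2, clamp s).
apply: (@cvg_comp _ _ _ p (on_spacetime F) _ _ _ _ (cF (p t) (clamp_ge0 t))) => U /= nU.
have cp : p s @[s --> t] --> p t.
  apply: (@cvg_pair _ _ _ _
    (nbhs ((v1, v2) : discrete_topology G * discrete_topology G))
    (nbhs (clamp t)) _ _ _ (fun=> (v1, v2)) clamp).
    exact: cvg_cst.
  exact: continuous_clamp.
by apply: (@filterS _ (nbhs t) _ _ _ _ (cp _ nU)) => s; apply; exact: clamp_ge0.
Qed.

Lemma near_clamp (f : R -> R) t : 0 < t -> \near t, f (clamp t) = f t.
Proof.
move=> t0; near=> s; rewrite clamp_id//; apply: ltW.
by near: s; exact: lt_nbhsr.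
Unshelve. all: by end_near. Qed.

(** At [t = 0] the [lim] in [heat_op_ext] is a genuine limit, since [K] agrees with [heat_op H] at
    positive times and its clamp is continuous at 0. *)
Lemma heat_op_ext_hclamp H K : hcontinuous (hclamp K) ->
  (forall v1 v2 t, 0 < t -> K v1 v2 t = heat_op H v1 v2 t) ->
  forall v1 v2 t, 0 <= t -> heat_op_ext H v1 v2 t = hclamp K v1 v2 t.
Proof.
move=> cK KH v1 v2 t t0; rewrite /heat_op_ext; case: eqVneq => [->|tN0].
  apply/cvg_lim; first exact: Rhausdorff.
  have : hclamp K v1 v2 s @[s --> 0^'+] --> hclamp K v1 v2 0.
    by apply: cvg_at_right_filter; exact: cK.
  apply: cvg_trans; apply: near_eq_cvg; near=> s.
  have s0 : 0 < s by near: s; exact: nbhs_right_gt.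
  by rewrite -KH// /hclamp clamp_id// ltW.
by rewrite /hclamp clamp_id// KH// lt_neqAle eq_sym tN0.
Unshelve. all: by end_near. Qed.

(** In [F = - P - P * F] the factor [P] already carries the power [t ^+ k], so in the convolution a
    crude bound on [F] near 0 is enough. *)
Lemma resolvent_bigO P k : hcontinuous P ->
  (forall v1 v2, exists2 c : R, 0 < c &
    \forall t \near 0^'+, `|P v1 v2 t| <= c * t ^+ k) ->
  exists c d : R, [/\ 0 <= c, 0 < d &
    forall v1 v2 t, 0 <= t <= d -> `|resolvent P v1 v2 t| <= c * t ^+ k].
Proof.
move=> cP Pk; have cF := hcontinuous_resolvent cP.
have /choice[c cPk] (p : G * G) : exists c : R, 0 < c /\
    \forall t \near 0^'+, `|P p.1 p.2 t| <= c * t ^+ k.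
  by have [c] := Pk p.1 p.2; exists c.
pose C := \sum_p c p.
have C0 : 0 <= C by apply: sumr_ge0 => p _; apply: ltW; have [] := cPk p.
have : \forall t \near 0^'+, forall p : G * G, `|P p.1 p.2 t| <= C * t ^+ k.
  apply: filter_forall => p; have [cp] := cPk p.
  move=> h; near=> t; have t0 : 0 <= t by near: t; exact: nbhs_right_ge.
  apply: (@le_trans _ _ (c p * t ^+ k)); first by near: t.
  rewrite ler_wpM2r ?exprn_ge0// /C (bigD1 p)//= lerDl.
  by apply: sumr_ge0 => q _; apply: ltW; have [] := cPk q.
move=> [d /= d0 Pd].
have Pd' v1 v2 t : 0 < t < d -> `|P v1 v2 t| <= C * t ^+ k.
  move=> /andP[t0 td]; apply: (Pd t _ t0 (v1, v2)).
  by rewrite /ball_/= sub0r normrN gtr0_norm.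
(* The estimates for convolutions use closed intervals, so the bound is needed at 0 too; for [k = 0]
   it is not trivial, as [0 ^+ 0 = 1]. *)
have P0 v1 v2 : `|P v1 v2 0| <= C * 0 ^+ k.
  have l1 : `|P v1 v2 t| @[t --> 0^'+] --> `|P v1 v2 0|.
    by apply: cvg_norm; apply: cvg_at_right_filter; exact: cP.
  have l2 : C * t ^+ k @[t --> 0^'+] --> C * 0 ^+ k.
    apply: cvg_at_right_filter; apply: cvgM; first exact: cvg_cst.
    exact: exprn_continuous.
  apply: (ler_cvg_to l1 l2); near=> t; apply: Pd'; apply/andP; split.
    by near: t; exact: nbhs_right_gt.
  by near: t; exact: nbhs_right_lt.
(* Halving [d] makes the closed interval [[0, e]] fit below [d]; [e <= 1] lets the additional factor
   [t] from the convolution be dropped. *)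
pose e := Num.min (d / 2) 1.
have e0 : 0 < e by rewrite lt_min ltr01 andbT divr_gt0.
have [B B0 FB] := hcontinuous_bounded e cF.
exists (C + #|G|%:R * (C * B)), e; split => //.
  by rewrite addr_ge0// !mulr_ge0.
have Pe v1 v2 t : 0 <= t <= e -> `|P v1 v2 t| <= C * t ^+ k.
  move=> /andP[]; rewrite le_eqVlt => /predU1P[<- _|t0]; first exact: P0.
  rewrite le_min => /andP[td _]; apply: Pd'; rewrite t0 (le_lt_trans td)//.
  by rewrite ltr_pdivrMr// ltr_pMr// ltr1n.
move=> v1 v2 t /andP[t0 te]; rewrite resolvent_eq//.
apply: (le_trans (ler_normB _ _)); rewrite normrN mulrDl; apply: lerD.
  by apply: Pe; rewrite t0.
apply: (@le_trans _ _ (#|G|%:R * ((C * t ^+ k) * B * t))).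
  apply: convolution_le => //.
    move=> w1 w2 r /andP[r0 rt].
    apply: (@le_trans _ _ (C * r ^+ k)); first by apply: Pe; rewrite r0 (le_trans rt).
    by rewrite ler_wpM2l// lerXn2r.
  by move=> w1 w2 r /andP[r0 rt]; apply: FB; rewrite r0 (le_trans rt).
rewrite (_ : C * t ^+ k * B * t = C * B * t ^+ k * t); last by ring.
rewrite !mulrA ler_piMr ?mulr_ge0 ?exprn_ge0//.
by rewrite (le_trans te)// ge_min lexx orbT.
Unshelve. all: by end_near. Qed.

Lemma convolution_resolvent_bigO H P k v1 v2 : hcontinuous H -> hcontinuous P ->
  (forall v1 v2, exists2 c : R, 0 < c &
    \forall t \near 0^'+, `|P v1 v2 t| <= c * t ^+ k) ->
  exists2 c : R, 0 < c &
    \forall t \near 0^'+, `|convolution H (resolvent P) v1 v2 t| <= c * t ^+ k.+1.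
Proof.
move=> cH cP Pk; have [c [d [c0 d0 Fc]]] := resolvent_bigO cP Pk.
have cF := hcontinuous_resolvent cP.
have [A A0 HA] := hcontinuous_bounded d cH.
(* The summand 1 makes the constant positive even if [A] or [c] is 0. *)
exists (#|G|%:R * (A * c) + 1); first by rewrite ltr_wpDl// !mulr_ge0.
near=> t.
have t0 : 0 <= t by near: t; exact: nbhs_right_ge.
have td : t <= d by near: t; exact: nbhs_right_le.
apply: (@le_trans _ _ (#|G|%:R * (A * (c * t ^+ k) * t))).
  apply: convolution_le => //.
    by move=> w1 w2 r /andP[r0 rt]; apply: HA; rewrite r0 (le_trans rt).
  move=> w1 w2 r /andP[r0 rt].
  apply: (@le_trans _ _ (c * r ^+ k)); first by apply: Fc; rewrite r0 (le_trans rt).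
  by rewrite ler_wpM2l// lerXn2r.
rewrite exprSr mulrDl mul1r !mulrA lerDl mulr_ge0// exprn_ge0//.
Unshelve. all: by end_near. Qed.

Lemma neumann_term_resolvent H P l v1 v2 t :
  (forall v1 v2 t, 0 <= t -> heat_op_ext H v1 v2 t = P v1 v2 t) -> 0 <= t ->
  neumann_term H l v1 v2 t = resolvent_term P l v1 v2 t.
Proof.
by move=> HP t0; congr (_ * _); exact: eq_convolution_pow.
Qed.

Lemma neumann_sum_resolvent H P n v1 v2 t :
  (forall v1 v2 t, 0 <= t -> heat_op_ext H v1 v2 t = P v1 v2 t) -> 0 <= t ->
  neumann_sum H n v1 v2 t = resolvent_sum P n v1 v2 t.
Proof. by move=> HP t0; apply: eq_bigr => l _; exact: neumann_term_resolvent. Qed.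

Lemma neumann_series_resolvent H P v1 v2 t :
  (forall v1 v2 t, 0 <= t -> heat_op_ext H v1 v2 t = P v1 v2 t) -> 0 <= t ->
  neumann_series H v1 v2 t = resolvent P v1 v2 t.
Proof.
move=> HP t0; rewrite /neumann_series /resolvent clamp_id//.
by congr (limn _); apply/funext => n; exact: neumann_sum_resolvent.
Qed.

Lemma compact_time_bounded (A : set (spacetime R G)) : compact A ->
  exists T : R, forall p, A p -> p.2 <= T.
Proof.
move=> cA; have /compact_bounded[M [_ MA]] : compact (snd @` A).
  apply: continuous_compact => //; apply: continuous_subspaceT => p.
  exact: cvg_snd.
exists (`|M| + 1) => p Ap; apply: (le_trans (ler_norm _)).
by apply: (MA (`|M| + 1)); [rewrite ltr_pwDr// ler_norm|exists p].
Qed.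

End parametrix.

Theorem theorem5 (R : realType) (G : weighted_graph R) (H : heat_fun G) (k : nat)
    (paramH : is_parametrix H) (orderH : has_order k H) :
  (forall A : set (spacetime R G), compact A -> A `<=` time_ge0 G ->
     (forall p, A p ->
        cvgn (fun n => \sum_(1 <= l < n) `|on_spacetime (neumann_term H l) p|)) /\
     {uniform A, (fun n => on_spacetime (neumann_sum H n)) @ \oo -->
        on_spacetime (neumann_series H)}) /\
  (forall (v1 v2 : G) (t : R), 0 <= t ->
     heat_kernel G v1 v2 t =
       H v1 v2 t + convolution H (neumann_series H) v1 v2 t) /\
  (forall v1 v2 : G,
     convolution H (neumann_series H) v1 v2 =O_ (0^'+) (fun t : R => t ^+ k.+1)).
Proof.
have [cH smoothH iH [K [cK KH]]] := paramH.
pose Hc := hclamp H; pose P := hclamp K.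
have {}cH : hcontinuous Hc by exact: hcontinuous_hclamp.
have cP : hcontinuous P by exact: hcontinuous_hclamp.
have HP := heat_op_ext_hclamp cP KH.
(* An equality for every real [t], since the integrals involve only nonnegative times. *)
have HF v1 v2 t : convolution H (neumann_series H) v1 v2 t =
    convolution Hc (resolvent P) v1 v2 t.
  apply: eq_convolution => w1 w2 r r0; first by rewrite /Hc /hclamp clamp_id.
  exact: neumann_series_resolvent.
split; [|split].
- move=> A cA A0; have [T AT] := compact_time_bounded cA.
  have [C C0 PC] := resolvent_term_le T cP.
  have bnd l p : (0 < l)%N -> A p ->
      `|on_spacetime (neumann_term H l) p| <= C / 2 ^+ l.
    move=> l0 Ap; have p0 := A0 _ Ap.
    rewrite /on_spacetime (neumann_term_resolvent l _ _ HP p0).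
    by apply: PC => //; rewrite [X in X && _]p0 AT.
  split; last exact: (half_pow_uniform C0 bnd).
  by move=> p Ap; apply: (half_pow_cvg_abs C0) => l l0; exact: bnd.
- move=> v1 v2 t t0; rewrite HF.
  have -> : H v1 v2 t = Hc v1 v2 t by rewrite /Hc /hclamp clamp_id.
  apply: (@heat_kernel_eq R G (fun v1 v2 t =>
    Hc v1 v2 t + convolution Hc (resolvent P) v1 v2 t) v1 v2 t _ t0).
  apply: (parametrix_solves cH cP) => w1 w2.
    (* Clamping changes nothing near a positive time, so the derivative of [H] itself may be used;
       it equals [P] minus the Laplacian by the definition of [heat_op]. *)
    move=> s s0; apply: (@near_eq_is_derive _ _ _ (H w1 w2)).
      by apply: filterS (near_clamp (H w1 w2) s0) => r.
    have dH : derivable (H w1 w2) s 1 by exact: (smoothH w1 w2 0%N).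
    rewrite (_ : _ - _ = derive1 (H w1 w2) s).
      by rewrite derive1E; exact/derivableP.
    rewrite /P /hclamp clamp_id ?ltW// KH// /heat_op /hlaplacian /Hc /hclamp.
    rewrite (_ : laplacian (fun v => H v w2 (clamp s)) w1 =
      laplacian (fun v => H v w2 s) w1); first by rewrite addrAC subrr add0r.
    by rewrite clamp_id// ltW.
  by rewrite /Hc /hclamp clamp_id// (iH w1 w2).1.
- move=> v1 v2; apply/eqO_exP.
  have [w1 w2|c c0 ck] := @convolution_resolvent_bigO R G Hc P k v1 v2 cH cP.
    have /eqO_exP[c c0 ck] := orderH w1 w2; exists c => //.
    near=> t; have t0 : 0 < t by near: t; exact: nbhs_right_gt.
    have t0' := ltW t0; rewrite /P /hclamp clamp_id// KH//.
    have : `|heat_op H w1 w2 t| <= c * `|t ^+ k| by near: t.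
    by rewrite [`|t ^+ k|]ger0_norm// exprn_ge0.
  exists c => //; near=> t; have t0 : 0 <= t by near: t; exact: nbhs_right_ge.
  by rewrite HF [`|t ^+ _|]ger0_norm ?exprn_ge0//; near: t.
Unshelve. all: by end_near. Qed.
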